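(* Let $\alpha\in[0,1)$ and let $G$ be a connected graph of order $n\ge 2$ with minimum degree $\delta$ and second minimum degree $\delta'$. Let $d$ be the diameter of $G$. Let $S=dn-\frac{d(d-1)}{2}-1-\delta(d-1)$ and $S'=dn-\frac{d(d-1)}{2}-1-\delta'(d-1)$. Then \[ \mu_{\alpha}(G)\ \le\ \frac{1}{2}\left(\alpha\bigl(2dn-2-(d-1)(d+\delta+\delta')\bigr)+\sqrt{\alpha^2\bigl(2dn-2-(d-1)(d+\delta+\delta')\bigr)^2-4(2\alpha-1)SS'}\right), \] with equality if and only if $G$ is regular with $d\le 2$.
   Context: All graphs are finite, simple and undirected; $d_G(u,v)$ is the distance between $u$ and $v$ in the connected graph $G$. If $(d_1,\dots,d_n)$ is the nonincreasing degree sequence of $G$ (order $n\ge2$), then the minimum degree is $d_n$ and the second minimum degree is $d_{n-1}$ (so they may coincide). The diameter of $G$ is the maximum distance between pairs of vertices. The transmission of a vertex $u$ is $T_G(u)=\sum_{v\in V(G)}d_G(u,v)$. Let $T(G)$ be the diagonal matrix of transmissions and $D(G)=(d_G(u,v))_{u,v\in V(G)}$ the distance matrix. For $\alpha\in[0,1)$, $D_{\alpha}(G)=\alpha T(G)+(1-\alpha)D(G)$, and $\mu_{\alpha}(G)$ (the distance $\alpha$-spectral radius) is the largest eigenvalue of the symmetric matrix $D_{\alpha}(G)$. *)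

(* Defs.v *)
From HB Require Import structures.
From mathcomp Require Import all_boot all_order all_algebra.
From mathcomp Require Import spectral sesquilinear polyrcf complex.
From mathcomp Require Import boolp classical_sets reals.

Set Implicit Arguments.
Unset Strict Implicit.
Unset Printing Implicit Defensive.

Import Order.TTheory GRing.Theory Num.Theory.
Local Open Scope ring_scope.

Section Graph.
Variables (V : finType) (e : rel V).
Implicit Types (u v : V) (k : nat).

Definition simple_graph : Prop := symmetric e /\ irreflexive e.

Definition connected_graph : Prop := forall u v, connect e u v.

Definition walk_of_length k u v : bool :=
  [exists p : k.-tuple V, path e u p && (last u p == v)].

(* The least length of a walk. A shortest walk has length < #|V|; the value is
   #|V| if v is not reachable from u. *)
Definition gdist u v : nat :=
  \big[minn/#|V|]_(k < #|V| | walk_of_length k u v) k.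

Lemma gdist_le_walk k u v : walk_of_length k u v -> (gdist u v <= k)%N.
Proof.
move=> wk; rewrite /gdist -minEnat -leEnat.
have [kV|Vk] := ltnP k #|V|; last by rewrite (le_trans (bigmin_le_id _ _ _ _)).
exact: (bigmin_le_cond #|V| (j := Ordinal kV) (fun i : 'I_#|V| => i : nat)).
Qed.

Lemma gdist_walk u v : connect e u v -> walk_of_length (gdist u v) u v.
Proof.
case/connectP=> p0 p0e ->; case: (shortenP p0e) => p pe pU _.
have pV : (size p < #|V|)%N.
  by rewrite -[(size p).+1]/(size (u :: p)) -(card_uniqP pU) max_card.
have wp : walk_of_length (size p) u (last u p).
  by apply/existsP; exists (in_tuple p); rewrite pe eqxx.
have := gdist_le_walk wp; rewrite /gdist.
elim/big_ind: _ => [|x y hx hy|i wi _ //]; first by rewrite leqNgt pV.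
by rewrite /minn; case: ifP.
Qed.

Definition diameter : nat := \max_(u : V) \max_(v : V) gdist u v.

Definition degree u : nat := #|[set v | e u v]|.

Definition degree_sequence : seq nat :=
  sort geq [seq degree u | u <- enum V].

(* d_n and d_(n-1), where n = #|V| and the sequence is indexed from 0. *)
Definition min_degree : nat := nth 0%N degree_sequence (#|V| - 1).
Definition second_min_degree : nat := nth 0%N degree_sequence (#|V| - 2).

Definition regular : Prop := exists r : nat, forall u, degree u = r.

Definition transmission u : nat := \sum_(v : V) gdist u v.

End Graph.

Section Spectrum.
Variables (R : realType) (n : nat).
Implicit Types A : 'M[R]_n.

(* sup is used only to make this total: for symmetric A and n > 0 the sup is a
   maximum, see largest_eigenvalueP. *)
Definition largest_eigenvalue A : R := sup [set a | eigenvalue A a]%classic.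

Lemma ubound_eigenvalue A :
  has_ubound [set a | eigenvalue A a]%classic.
Proof.
exists (\sum_i \sum_j `|A i j|) => a /= /eigenvalueP[v vA vn0].
have [j0 vj0] : exists j, v 0 j != 0.
  apply/existsP; apply: contraNT vn0; rewrite negb_exists => /forallP h.
  by apply/eqP/rowP=> j; rewrite mxE; apply/eqP; have := h j; rewrite negbK.
pose j := [arg max_(j > j0) `|v 0 j|]%O.
have jmax i : `|v 0 i| <= `|v 0 j|.
  by rewrite /j; case: Order.TotalTheory.arg_maxP => // k _ h; exact: h.
have vj : 0 < `|v 0 j| by apply: lt_le_trans (jmax j0); rewrite normr_gt0.
apply: le_trans (ler_norm _) _; rewrite -(ler_pM2r vj) -normrM.
have -> : a * v 0 j = \sum_i v 0 i * A i j.
  by have /rowP/(_ j) := vA; rewrite !mxE.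
apply: le_trans (ler_norm_sum _ _ _) _; rewrite mulr_suml; apply: ler_sum => i _.
rewrite normrM mulrC; apply: ler_pM => //.
by rewrite (bigD1 j) //= lerDl sumr_ge0.
Qed.

Lemma symmetric_eigenvalue A : (0 < n)%N -> A^T = A ->
  exists a, eigenvalue A a.
Proof.
move=> n0 AT; pose f := real_complex R; pose AC := map_mx f A.
have AH : AC \is hermsymmx.
  apply: realsym_hermsym.
    by apply/is_hermitianmxP; rewrite expr0 scale1r map_mx_id // map_trmx AT.
  by apply/mxOverP=> i j; rewrite mxE; apply/complex_realP; exists (A i j).
have /orthomx_spectralP AE := hermitian_normalmx AH.
have i0 : 'I_n by case: n n0 => // m _; exact: ord0.
set P := spectralmx AC in AE; set d := spectral_diag AC in AE.
have PU : P \in unitmx := spectral_unit AC.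
have /complex_realP[a da] : d 0 i0 \is Num.real.
  by have /mxOverP := hermitian_spectral_diag_real AH; apply.
suff: eigenvalue AC (f a).
  rewrite !eigenvalue_root_char -map_char_poly fmorph_root.
  by exists a; rewrite eigenvalue_root_char.
rewrite [f a](_ : _ = d 0 i0); last by rewrite da.
apply/eigenvalueP; exists (row i0 P).
  have PA : P *m AC = diag_mx d *m P.
    by rewrite [in LHS]AE !mulmxA mulmxV // mul1mx.
  by rewrite -row_mul PA mul_diag_mx; apply/rowP=> j; rewrite !mxE.
apply/eqP => r0; have := mulmxV PU => /(congr1 (row i0)).
rewrite row_mul r0 mul0mx => /rowP/(_ i0); rewrite !mxE eqxx => /eqP.
by rewrite eq_sym oner_eq0.
Qed.

Lemma largest_eigenvalueP A : (0 < n)%N -> A^T = A ->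
  eigenvalue A (largest_eigenvalue A) /\
  forall a, eigenvalue A a -> a <= largest_eigenvalue A.
Proof.
move=> n0 AT; split; last by move=> a; apply: ub_le_sup (ubound_eigenvalue A) _.
have [a0 Aa0] := symmetric_eigenvalue n0 AT.
set s := roots (char_poly A) (a0 - 1) (largest_eigenvalue A + 1).
have sP a : a0 <= a -> eigenvalue A a -> a \in s.
  move=> a0a Aa; rewrite in_roots -eigenvalue_root_char Aa in_itv /=.
  rewrite (monic_neq0 (char_poly_monic A)) andbT; apply/andP; split.
    by rewrite (lt_le_trans _ a0a) // gtrDl ltrN10.
  by rewrite (le_lt_trans (ub_le_sup (ubound_eigenvalue A) _)) ?ltrDl.
pose m := \big[Order.max/a0]_(x <- s) x.
have Am : eigenvalue A m.
  rewrite /m big_seq; elim/big_ind: _ => // [x y Ax Ay|x /root_roots].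
    by rewrite /Order.max; case: ifP.
  by rewrite eigenvalue_root_char.
suff -> : largest_eigenvalue A = m by [].
apply/le_anti/andP; split; last exact: ub_le_sup (ubound_eigenvalue A) _ Am.
apply: ge_sup; first by exists a0.
move=> a /= Aa; have [a0a|/ltW aa0] := leP a0 a.
  by apply: (le_bigmax_seq a0 a xpredT id); rewrite ?sP.
by rewrite (le_trans aa0) // bigmax_ge_id.
Qed.

End Spectrum.

Section DistanceAlpha.
Variables (R : realType) (V : finType) (e : rel V).

(* Rows and columns are indexed by 'I_#|V| through enum_val. *)
Definition transmission_mx : 'M[R]_#|V| :=
  diag_mx (\row_i (transmission e (enum_val i))%:R).

Definition distance_mx : 'M[R]_#|V| :=
  \matrix_(i, j) (gdist e (enum_val i) (enum_val j))%:R.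

Definition distance_alpha_mx (alpha : R) : 'M[R]_#|V| :=
  alpha *: transmission_mx + (1 - alpha) *: distance_mx.

Definition distance_alpha_spectral_radius (alpha : R) : R :=
  largest_eigenvalue (distance_alpha_mx alpha).

Lemma distance_alpha_spectral_radiusP (alpha : R) :
  (0 < #|V|)%N -> symmetric e ->
  let mu := distance_alpha_spectral_radius alpha in
  eigenvalue (distance_alpha_mx alpha) mu /\
  forall a, eigenvalue (distance_alpha_mx alpha) a -> a <= mu.
Proof.
move=> V0 eC; apply: largest_eigenvalueP => //.
rewrite /distance_alpha_mx raddfD /= !linearZ /= tr_diag_mx; congr (_ + _ *: _).
apply/matrixP=> i j; rewrite !mxE; congr _%:R; rewrite /gdist.
apply: eq_bigl => k.
have walkC u v : walk_of_length e k u v -> walk_of_length e k v u.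
  case/existsP=> p /andP[pe /eqP pv]; apply/existsP.
  have sp : size (rev (belast u p)) == k by rewrite size_rev size_belast size_tuple.
  exists (Tuple sp); apply/andP; split=> /=.
    by rewrite -pv rev_path (eq_path (e' := e)) // => x y; rewrite eC.
  by case: {+}(val p) pv => [<- //|x q _]; rewrite /= rev_cons last_rcons.
by apply/idP/idP; apply: walkC.
Qed.

End DistanceAlpha.

(* Main.v *)
(** If d(v) denotes the distance from u, then [sum_v (d - d(v))] is the sum over
    j < d of the sizes of the balls B_j(u).  For 0 < j < d such a ball has at
    least deg u + j elements: either every level up to j is inhabited, or the
    ball is everything and a diametral path, which meets the closed
    neighbourhood of u in at most three vertices, gives n >= deg u + d - 1.
    Hence T(u) <= dn - d(d-1)/2 - 1 - deg u (d-1).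

    For an eigenvector x of mu, let u and v carry the two largest moduli.  Rows
    u and v give (mu - alpha T(u)) (mu - alpha T(v)) <= (1 - alpha)^2 T(u) T(v),
    whereas the bound is the larger root b of
    (b - alpha S) (b - alpha S') = (1 - alpha)^2 S S'.

    If mu = b and n > 2, all |x_w| are equal and all transmissions equal S, so
    the graph is regular and, if d > 2, every vertex has exactly one vertex at
    distance 2.  This is impossible: along a geodesic p0 p1 p2 p3 a second
    neighbour q of p0 would have to be adjacent to p1, then to p2, and would
    then be a second vertex at distance 2 from p3. *)

Require Import Defs.
From mathcomp Require Import all_boot all_order all_algebra.
From mathcomp Require Import reals.
From mathcomp Require Import zify ring lra.

Set Implicit Arguments.
Unset Strict Implicit.
Unset Printing Implicit Defensive.

Import Order.TTheory GRing.Theory Num.Theory.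
Local Open Scope ring_scope.

(** Distinct values of [f] need distinct elements of [B :\: A]. With [f] a distance from a fixed
    vertex, this counts inhabited levels outside a ball. *)
Lemma card_setD_values (T : finType) (f : T -> nat) (A B : {set T})
    (s : seq nat) :
  A \subset B -> uniq s ->
  (forall i, i \in s -> exists w, w \in B :\: A /\ f w = i) ->
  (#|A| + size s <= #|B|)%N.
Proof.
move=> AB us sP.
have -> : #|B| = (#|A| + #|B :\: A|)%N.
  by rewrite cardsD (setIidPr AB) subnKC // subset_leq_card.
rewrite leq_add2l cardE -(size_map f).
apply: uniq_leq_size => // i /sP[w [wBA <-]].
by apply: map_f; rewrite mem_enum.
Qed.

(** * Graph distance as a metric, and geodesics *)

Section GraphDistance.
Variables (V : finType) (e : rel V).
Hypotheses (eS : symmetric e) (eI : irreflexive e) (eC : connected_graph e).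
Implicit Types (u v w : V) (j k : nat).

Lemma walkP k u v :
  reflect (exists p, [/\ path e u p, last u p = v & size p = k])
          (walk_of_length e k u v).
Proof.
apply: (iffP existsP) => [[p /andP[pe /eqP pv]]|[p [pe pv pk]]].
  by exists p; rewrite size_tuple.
by move/eqP: pk => pk; exists (Tuple pk); rewrite /= pe pv eqxx.
Qed.

Lemma gdistP u v :
  exists p, [/\ path e u p, last u p = v & size p = gdist e u v].
Proof. exact/walkP/gdist_walk/eC. Qed.

Lemma gdist_le_path u p : path e u p -> (gdist e u (last u p) <= size p)%N.
Proof. by move=> pe; apply/gdist_le_walk/walkP; exists p. Qed.

Lemma gdistxx u : gdist e u u = 0%N.
Proof. by have := @gdist_le_path u [::] isT; rewrite leqn0 => /eqP. Qed.

Lemma gdist_eq0 u v : (gdist e u v == 0%N) = (u == v).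
Proof.
apply/eqP/eqP => [uv0|->]; last exact: gdistxx.
by have [p [_ pv]] := gdistP u v; rewrite uv0 -pv => /size0nil ->.
Qed.

Lemma gdist_eq1 u v : (gdist e u v == 1%N) = e u v.
Proof.
apply/eqP/idP => [uv1|uv].
  have [[|w [|? ?]] [/=]] := gdistP u v; rewrite uv1 //.
  by rewrite andbT => + <-.
have := @gdist_le_path u [:: v]; rewrite /= uv => /(_ isT).
have : gdist e u v != 0%N.
  by rewrite gdist_eq0; apply: contraTneq uv => ->; rewrite eI.
by lia.
Qed.

Lemma gdist_triangle u v w : (gdist e u w <= gdist e u v + gdist e v w)%N.
Proof.
have [p [pe <- <-]] := gdistP u v.
have [q [qe <- <-]] := gdistP (last u p) w.
by rewrite -size_cat -last_cat gdist_le_path // cat_path pe.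
Qed.

Lemma gdistC u v : gdist e u v = gdist e v u.
Proof.
suff le x y : (gdist e x y <= gdist e y x)%N by apply/eqP; rewrite eqn_leq !le.
have [p [pe <- <-]] := gdistP y x; rewrite -(size_belast y) -size_rev.
have -> : gdist e (last y p) y =
    gdist e (last y p) (last (last y p) (rev (belast y p))).
  by case: (p) => [//|z q]; rewrite /= rev_cons last_rcons.
by apply: gdist_le_path; rewrite rev_path (eq_path (e' := e)).
Qed.

Lemma gdist_pred k u v : gdist e u v = k.+1 ->
  exists2 w, gdist e u w = k & e w v.
Proof.
move=> uvk; have [p] := gdistP u v; rewrite uvk.
case/lastP: p => [[] //|p v']; rewrite rcons_path last_rcons size_rcons.
case=> /andP[pe ev] v'v [pk]; rewrite {v'}v'v in ev.
exists (last u p) => //; apply/eqP; rewrite eqn_leq -{1}pk gdist_le_path //=.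
have := gdist_triangle u (last u p) v; move: ev; rewrite -gdist_eq1 => /eqP ->.
by rewrite uvk; lia.
Qed.

(** Induction on the remaining length [m], removing the last edge of a geodesic; the triangle
    inequality turns the bounds on the two halves into equalities. *)
Lemma gdist_intermediate k u v : (k <= gdist e u v)%N ->
  exists2 w, gdist e u w = k & (gdist e w v = gdist e u v - k)%N.
Proof.
move=> kuv; have := subnKC kuv; move: (_ - k)%N => m.
elim: m v {kuv} => [|m IHm] v.
  by rewrite addn0; exists v => //; rewrite gdistxx.
rewrite addnS => /esym uv; have [w uw ewv] := gdist_pred uv.
have [x ux xw] := IHm w (esym uw); exists x => //.
have := gdist_triangle x w v; have := gdist_triangle u x v.
by move: ewv; rewrite -gdist_eq1 => /eqP ->; lia.
Qed.

Lemma gdist_le_diameter u v : (gdist e u v <= diameter e)%N.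
Proof.
rewrite (leq_trans (leq_bigmax (F := fun w => gdist e u w) v)) //.
exact: (leq_bigmax (F := fun x => \max_w gdist e x w) u).
Qed.

Lemma diameter_attained : (0 < diameter e)%N ->
  exists u v, gdist e u v = diameter e.
Proof.
move=> d0; have V0 : (0 < #|V|)%N.
  rewrite lt0n; apply: contraTneq d0 => V0.
  by rewrite /diameter big_pred0 // => x; have := fintype0 x V0.
rewrite /diameter.
have [u ->] := @bigop.eq_bigmax V (fun u => \max_v gdist e u v) V0.
by have [v ->] := @bigop.eq_bigmax V (gdist e u) V0; exists u, v.
Qed.

(** * Ball sizes and the upper bound on transmissions *)

Definition ball u j : {set V} := [set v | (gdist e u v <= j)%N].

(** Double counting: a vertex [v] lies in exactly [diameter e - gdist e u v] of the balls of radius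
    [j < diameter e]. *)
Lemma sum_gdist_ball u :
  (transmission e u + \sum_(j < diameter e) #|ball u j| = diameter e * #|V|)%N.
Proof.
have -> : (\sum_(j < diameter e) #|ball u j| =
    \sum_v (diameter e - gdist e u v))%N.
  rewrite (eq_bigr (fun j : 'I_(diameter e) =>
    \sum_v (gdist e u v <= j)%N : nat)%N).
    rewrite exchange_big; apply: eq_bigr => v _ /=.
    rewrite -(big_mkord xpredT (fun j => (gdist e u v <= j)%N : nat)).
    rewrite (@big_cat_nat _ _ _ (gdist e u v)) ?gdist_le_diameter //=.
    rewrite big_nat big1 ?add0n => [|j /andP[_ h]]; last by rewrite leqNgt h.
    rewrite big_nat (eq_bigr (fun=> 1%N)) => [|j /andP[-> //]].
    by rewrite -big_nat sum_nat_const_nat muln1.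
  move=> j _; rewrite -sum1_card big_mkcond; apply: eq_bigr => v _.
  by rewrite inE; case: (_ <= _)%N.
rewrite -big_split (eq_bigr (fun=> diameter e)) /=; last first.
  by move=> v _; rewrite subnKC ?gdist_le_diameter.
by rewrite sum_nat_const mulnC.
Qed.

Lemma ball0 u : ball u 0 = [set u].
Proof. by apply/setP=> v; rewrite !inE leqn0 gdist_eq0 eq_sym. Qed.

Lemma card_ball1 u : #|ball u 1| = (degree e u).+1.
Proof.
rewrite /degree (_ : ball u 1 = u |: [set v | e u v]).
  by rewrite cardsU1 inE eI add1n.
apply/setP=> v; rewrite !inE -gdist_eq1 leq_eqVlt ltnS leqn0 gdist_eq0.
by rewrite orbC eq_sym.
Qed.

(* The levels of a diametral endpoint are all nonempty, and a closed
   neighbourhood meets at most three consecutive ones. *)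
Lemma degree_diameter_le u : (0 < diameter e)%N ->
  (degree e u + diameter e <= #|V|.+1)%N.
Proof.
move=> d0; have [a [b abd]] := diameter_attained d0.
set d := diameter e in d0 abd *; set i := gdist e a u.
(* At [i = 0] the predecessor is again [0]; the repetition does no harm, as [r] only serves to show
   that at most three levels are near [u]. *)
set r := [:: i.-1; i; i.+1].
set far := [seq k <- iota 0 d.+1 | k \notin r].
have sz : (d - 2 <= size far)%N.
  pose near := [seq k <- iota 0 d.+1 | k \in r].
  have : (size near + size far = d.+1)%N.
    by rewrite !size_filter -[RHS](size_iota 0) -(count_predC [in r]).
  have : (size near <= size r)%N.
    apply: uniq_leq_size; first by rewrite filter_uniq // iota_uniq.
    by move=> k; rewrite mem_filter => /andP[].
  by rewrite /=; lia.
have : (#|ball u 1| + size far <= #|[set: V]|)%N.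
  apply: (card_setD_values (f := gdist e a)) => [||k]; first exact: subsetT.
    by rewrite filter_uniq // iota_uniq.
  rewrite mem_filter mem_iota => /andP[kr kd].
  have [|w wk _] := @gdist_intermediate k a b; first by lia.
  exists w; split => //; rewrite !inE andbT.
  apply: contra kr => uw; rewrite !inE.
  have := gdist_triangle a u w; have := gdist_triangle a w u.
  by rewrite (gdistC w u) -/i; lia.
by rewrite cardsT card_ball1; lia.
Qed.

Lemma card_ball_ge u j : (0 < j < diameter e)%N ->
  (degree e u + j <= #|ball u j|)%N.
Proof.
move=> jd; have [/existsP[v juv]|/existsPn far] :=
    boolP [exists v, (j <= gdist e u v)%N]; last first.
  have -> : ball u j = setT.
    by apply/setP=> v; rewrite !inE; have := far v; lia.
  by rewrite cardsT; have := degree_diameter_le u; lia.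
(* The closed neighbourhood gives [degree e u + 1] vertices, and the levels 2 to [j] give [j - 1]
   more. *)
have : (#|ball u 1| + size (iota 2 j.-1) <= #|ball u j|)%N.
  apply: (card_setD_values (f := gdist e u)) => [||k]; rewrite ?iota_uniq //.
    by apply/subsetP=> w; rewrite !inE; lia.
  rewrite mem_iota => kj.
  have [|w wk _] := @gdist_intermediate k u v; first by lia.
  by exists w; rewrite !inE wk; split => //; lia.
by rewrite size_iota card_ball1; lia.
Qed.

(** This is the total of the lower bounds on ball sizes, with the radius 0 term equal to 1. Doubling
    keeps the triangular number free of division in [nat]. *)
Lemma sum_degree_add u : (0 < diameter e)%N ->
  (2 * (1 + \sum_(j < (diameter e).-1) (degree e u + j.+1)) =
   2 + 2 * degree e u * (diameter e).-1 + (diameter e).-1 * diameter e)%N.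
Proof.
case: (diameter e) => //= D _.
elim: D => [|D IHD]; first by rewrite big_ord0; lia.
by rewrite big_ord_recr /= addnA mulnDr IHD; lia.
Qed.

Lemma sum_ball_recl u : (0 < diameter e)%N ->
  (\sum_(j < diameter e) #|ball u j| =
   1 + \sum_(j < (diameter e).-1) #|ball u j.+1|)%N.
Proof.
case: (diameter e) => //= D _.
by rewrite big_ord_recl /= ball0 cards1.
Qed.

Lemma transmission_le u : (0 < diameter e)%N ->
  (2 * transmission e u + (2 + 2 * degree e u * (diameter e).-1 +
   (diameter e).-1 * diameter e) <= 2 * (diameter e * #|V|))%N.
Proof.
move=> d0; rewrite -(sum_gdist_ball u) -(sum_degree_add u) //
  (mulnDr 2 (transmission e u)) leq_add2l.
rewrite leq_mul2l /= sum_ball_recl // leq_add2l leq_sum // => j _.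
by apply: card_ball_ge; have := ltn_ord j; lia.
Qed.

(** Equality of the sums forces equality in every term; the term of index 1 concerns the ball of
    radius 2 and is present because the diameter exceeds 2. *)
Lemma transmission_eq_card_ball2 u : (2 < diameter e)%N ->
  (2 * transmission e u + (2 + 2 * degree e u * (diameter e).-1 +
   (diameter e).-1 * diameter e) = 2 * (diameter e * #|V|))%N ->
  #|ball u 2| = (degree e u + 2)%N.
Proof.
move=> d2; have d0 : (0 < diameter e)%N by lia.
rewrite -(sum_gdist_ball u) -(sum_degree_add u) //
  (mulnDr 2 (transmission e u)) => /addnI /eqP.
rewrite eqn_mul2l /= sum_ball_recl // eqn_add2l => /eqP sumE.
have d1 : (1 < (diameter e).-1)%N by lia.
have h (j : 'I_(diameter e).-1) : (degree e u + j.+1 <= #|ball u j.+1|)%N.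
  by apply: card_ball_ge; have := ltn_ord j; lia.
have [_] := leqif_sum (P := xpredT)
  (fun (j : 'I_(diameter e).-1) _ => leqif_eq (h j)).
by rewrite sumE eqxx => /esym/forallP/(_ (Ordinal d1))/eqP ->.
Qed.

(** Only balls of radius 0 and 1 enter the sum, and their sizes are known exactly. *)
Lemma transmission_eq_of_diameter_le2 u : (0 < diameter e <= 2)%N ->
  (2 * transmission e u + (2 + 2 * degree e u * (diameter e).-1 +
   (diameter e).-1 * diameter e) = 2 * (diameter e * #|V|))%N.
Proof.
case/andP=> d0 d2; rewrite -(sum_gdist_ball u) sum_ball_recl //.
have [->|->] : diameter e = 1%N \/ diameter e = 2%N by lia.
  by rewrite big_ord0; lia.
by rewrite big_ord_recl big_ord0 /= card_ball1; lia.
Qed.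

(** * Exclusion of diameter above 2, and the small diameters *)

Lemma card_ball2_uniq u v w : #|ball u 2| = (degree e u + 2)%N ->
  gdist e u v = 2%N -> gdist e u w = 2%N -> v = w.
Proof.
move=> b2 uv uw; apply/eqP/negPn/negP => vw.
have : (#|v |: (w |: ball u 1)| <= #|ball u 2|)%N.
  apply/subset_leq_card/subsetP=> x; rewrite !inE.
  by case/or3P=> [/eqP->|/eqP->|]; rewrite ?uv ?uw //; lia.
by rewrite !cardsU1 !inE uv uw (negPf vw) /= card_ball1 b2; lia.
Qed.

Lemma regular_card_ball2_diameter : regular e ->
  ((2 < diameter e)%N -> forall u, #|ball u 2| = (degree e u + 2)%N) ->
  (diameter e <= 2)%N.
Proof.
move=> [r rP] b2; rewrite leqNgt; apply/negP => d2.
have {b2}uniq2 u v w : gdist e u v = 2%N -> gdist e u w = 2%N -> v = w.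
  exact/card_ball2_uniq/b2.
have [p0 [b p0b]] := diameter_attained (ltnW (ltnW d2)).
have [|p3 p03 _] := @gdist_intermediate 3 p0 b; first by lia.
have [|p1 p01 p13] := @gdist_intermediate 1 p0 p3; first by lia.
have [|p2 p12 p23] := @gdist_intermediate 1 p1 p3; first by lia.
rewrite p03 in p13; rewrite p13 in p23.
have p02 : gdist e p0 p2 = 2%N.
  have := gdist_triangle p0 p1 p2; have := gdist_triangle p0 p2 p3; lia.
(* [p1] has the two neighbours [p0] and [p2]; regularity transfers this count to [p0]. *)
have : (1 < degree e p0)%N.
  rewrite rP -(rP p1) (_ : 2%N = #|[set p0; p2]|); last first.
    by rewrite cards2 -gdist_eq0 p02.
  apply/subset_leq_card/subsetP=> x; rewrite !inE -gdist_eq1.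
  by case/orP=> /eqP ->; rewrite ?p12 // gdistC p01.
rewrite /degree (cardsD1 p1) inE -gdist_eq1 p01 eqxx ltnS => /card_gt0P[q].
rewrite !inE -gdist_eq1 => /andP[qp1 /eqP p0q].
have nq (x y z : V) : gdist e x z = 2%N -> y != z -> gdist e x y != 2%N.
  by move=> xz; apply: contra => /eqP xy; apply/eqP/(uniq2 x).
have qp3 : q != p3 by apply: contraTneq isT => qp3; move: p0q; rewrite qp3 p03.
have qp0 : q != p0 by rewrite eq_sym -gdist_eq0 p0q.
(* The unique vertices at distance 2 from [p1], [p2], [p3] are [p3], [p0], [p1], all different from
   [q]. So [q] is adjacent to [p1], hence to [p2], hence within 2 of [p3]; but [gdist e p0 p3 = 3]
   puts it at distance at least 2. *)
have := nq p1 q p3 p13 qp3; have := nq p2 q p0 (etrans (gdistC _ _) p02) qp0.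
have := nq p3 q p1 (etrans (gdistC _ _) p13) qp1.
have := gdist_eq0 p1 q; rewrite [p1 == q]eq_sym (negPf qp1).
have := gdist_triangle p1 p0 q; rewrite (gdistC p1 p0).
have := gdist_triangle p2 p1 q; rewrite (gdistC p2 p1).
have := gdist_triangle p3 p2 q; rewrite (gdistC p3 p2).
have := gdist_triangle p0 q p2; have := gdist_triangle p0 q p3.
rewrite (gdistC q p3) (gdistC q p2).
lia.
Qed.

(** Such a graph is complete. This settles the equality case where a third vertex may be missing. *)
Lemma regular_of_diameter1 : (diameter e <= 1)%N -> regular e.
Proof.
move=> d1; exists (#|V| - 1)%N => u.
have : #|ball u 1| = #|V|.
  rewrite -cardsT; congr #|pred_of_set _|; apply/setP=> v.
  by rewrite !inE (leq_trans (gdist_le_diameter _ _)).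
by rewrite card_ball1; lia.
Qed.

(** From an end of a diametral geodesic, the distances 0, 1 and [diameter e] are distinct and
    attained. *)
Lemma card_gt2_of_diameter : (1 < diameter e)%N -> (2 < #|V|)%N.
Proof.
move=> d1; have [u [v uv]] := diameter_attained (ltnW d1).
have [|w uw wv] := @gdist_intermediate 1 u v; first by lia.
have : (#|@set0 V| + size [:: 0; 1; diameter e]%N <= #|[set: V]|)%N.
  apply: (card_setD_values (f := gdist e u)) => [||k]; first exact: sub0set.
    by rewrite /= !inE; lia.
  rewrite !inE => /or3P[] /eqP ->.
  - by exists u; rewrite !inE gdistxx.
  - by exists w; rewrite !inE.
  - by exists v; rewrite !inE.
by rewrite cards0 cardsT.
Qed.

Lemma diameter_gt0 : (1 < #|V|)%N -> (0 < diameter e)%N.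
Proof.
case/card_gt1P=> u [v [_ _ uv]].
by rewrite (leq_trans _ (gdist_le_diameter u v)) // lt0n gdist_eq0.
Qed.

Lemma transmission_gt0 u : (1 < #|V|)%N -> (0 < transmission e u)%N.
Proof.
move=> V1; have /card_gt0P[v] : (0 < #|[set~ u]|)%N by rewrite cardsC1; lia.
rewrite !inE => vu; rewrite /transmission (bigD1 v) //= addn_gt0 lt0n.
by rewrite gdist_eq0 eq_sym vu.
Qed.

End GraphDistance.

(** * The two smallest degrees *)

Section DegreeSequence.
Variables (V : finType) (e : rel V).
Local Notation s := (degree_sequence e).

Lemma size_degree_sequence : size s = #|V|.
Proof. by rewrite size_sort size_map -cardE. Qed.

Lemma degree_sequence_nth_mem i : (i < #|V|)%N ->
  exists u, nth 0%N s i = degree e u.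
Proof.
rewrite -size_degree_sequence => /(mem_nth 0%N).
by rewrite mem_sort => /mapP[u _ ->]; exists u.
Qed.

Lemma degree_sequence_nonincreasing i j : (i <= j < #|V|)%N ->
  (nth 0 s j <= nth 0 s i)%N.
Proof.
case/andP=> ij jV.
have geqt : transitive geq by move=> a b c /= ba ac; exact: leq_trans ac ba.
apply: (sorted_leq_nth (leT := geq) geqt _ 0%N) => //.
- exact: leqnn.
- by apply: sort_sorted => a b; exact: leq_total.
- by rewrite inE size_degree_sequence (leq_ltn_trans ij).
- by rewrite inE size_degree_sequence.
Qed.

Lemma min_degree_le u : (min_degree e <= degree e u)%N.
Proof.
have V0 : (0 < #|V|)%N by apply/card_gt0P; exists u.
have : degree e u \in s by rewrite mem_sort map_f // mem_enum.
move/(nthP 0%N) => [i]; rewrite size_degree_sequence => iV <-.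
by apply: degree_sequence_nonincreasing; lia.
Qed.

(** Otherwise two entries of the degree sequence would lie strictly below its last but one entry,
    whereas only the last entry can. *)
Lemma second_min_degree_le u v : u != v ->
  (second_min_degree e <= degree e u)%N ||
  (second_min_degree e <= degree e v)%N.
Proof.
move=> uv; rewrite -[X in is_true X]negbK negb_or -!ltnNge.
set d2 := second_min_degree e; apply/negP=> /andP[ud vd].
have V1 : (1 < #|V|)%N by apply/card_gt1P; exists u, v.
have : (2 <= count (fun k => k < d2)%N s)%N.
  rewrite (permP (permEl (perm_sort _ _))) count_map -size_filter.
  apply: (@uniq_leq_size _ [:: u; v]); first by rewrite /= inE uv.
  by move=> w; rewrite !inE mem_filter mem_enum /= andbT => /orP[] /eqP ->.
rewrite -(cat_take_drop (#|V| - 1) s) count_cat.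
have -> : count (fun k => k < d2)%N (take (#|V| - 1) s) = 0%N.
  apply/eqP; rewrite -leqn0 leqNgt -has_count; apply/negP => /hasP[k].
  move/(nthP 0%N) => [i]; rewrite size_takel ?size_degree_sequence; last by lia.
  move=> iV; rewrite nth_take // => <-; rewrite ltnNge => /negP; apply.
  by apply: degree_sequence_nonincreasing; lia.
have := count_size (fun k => k < d2)%N (drop (#|V| - 1) s).
by rewrite size_drop size_degree_sequence; lia.
Qed.

End DegreeSequence.

(** * The quadratic inequality for the two largest moduli *)

Section Analysis.
Variable R : realType.

(* S1 and S2 bound the transmissions t1, t2 of the vertices carrying the largest
   and second largest moduli X, Y of an eigenvector for a. *)
Lemma two_entry_bound (alpha a b t1 t2 S1 S2 X Y : R) :
  0 <= alpha < 1 -> 0 < t1 <= S1 -> 0 < t2 <= S2 ->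
  alpha * S1 < b -> alpha * S2 < b ->
  (b - alpha * S1) * (b - alpha * S2) = (1 - alpha) ^+ 2 * (S1 * S2) ->
  0 < X ->
  (a - alpha * t1) * X <= (1 - alpha) * t1 * Y ->
  (a - alpha * t2) * Y <= (1 - alpha) * t2 * X ->
  a <= b /\
  (a = b -> [/\ t1 = S1, t2 = S2, (a - alpha * t1) * X = (1 - alpha) * t1 * Y
             & (a - alpha * t2) * Y = (1 - alpha) * t2 * X]).
Proof.
move=> /andP[a0 a1] /andP[t10 tS1] /andP[t20 tS2] bS1 bS2 bE X0 h1 h2.
have at1 : alpha * t1 <= alpha * S1 by rewrite ler_wpM2l.
have at2 : alpha * t2 <= alpha * S2 by rewrite ler_wpM2l.
have tt : t1 * t2 <= S1 * S2 by rewrite ler_pM // ltW.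
have c0 : 0 < 1 - alpha by lra.
(* Multiply [h1] by [a - alpha * t2], nonnegative because [b <= a], and [h2] by [(1 - alpha) * t1];
   chain them through [Y] and cancel [X]. *)
have key : b <= a ->
    (a - alpha * t1) * (a - alpha * t2) <= (1 - alpha) ^+ 2 * (t1 * t2).
  move=> ba; rewrite -(ler_pM2r X0).
  have := @ler_wpM2r _ (a - alpha * t2) _ _ _ h1.
  have := @ler_wpM2l _ ((1 - alpha) * t1) _ _ _ h2.
  have -> : 0 <= (1 - alpha) * t1 by rewrite mulr_ge0 // ltW.
  have -> : 0 <= a - alpha * t2 by lra.
  move=> /(_ isT) g1 /(_ isT) g2; lra.
have ttc : (1 - alpha) ^+ 2 * (t1 * t2) <= (1 - alpha) ^+ 2 * (S1 * S2).
  by rewrite ler_wpM2l // sqr_ge0.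
split.
  rewrite leNgt; apply/negP => ba; have := key (ltW ba).
  have : (b - alpha * S1) * (b - alpha * S2) <
      (a - alpha * t1) * (a - alpha * t2).
    by apply: ltr_pM; lra.
  by move: ttc; rewrite -bE; lra.
move=> ab; have k := key (eq_ind_r (fun z => b <= z) (lexx b) ab).
have k' : (b - alpha * S1) * (b - alpha * S2) <=
    (a - alpha * t1) * (a - alpha * t2).
  by apply: ler_pM; lra.
(* For [a = b], the facts [k'], [k] and [ttc] form a chain whose two ends agree by [bE], so it
   collapses. *)
have tE : t1 * t2 = S1 * S2.
  have /mulfI : (1 - alpha) ^+ 2 != 0 by rewrite expf_neq0 // gt_eqF.
  by apply; lra.
have e1 : t1 = S1.
  apply/eqP; rewrite eq_le tS1 /= leNgt; apply/negP => lt.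
  have : t1 * t2 < S1 * S2.
    apply: (@lt_le_trans _ _ (S1 * t2)); first by rewrite ltr_pM2r.
    by rewrite ler_wpM2l // ltW // (lt_trans t10).
  by rewrite tE ltxx.
have e2 : t2 = S2 by apply: (mulfI (lt0r_neq0 t10)); rewrite tE -e1.
rewrite -e1 -e2 -ab in bS1 bS2 bE.
have p1 : 0 < a - alpha * t1 by lra.
have p2 : 0 < a - alpha * t2 by lra.
(* [g1] and [g2] enclose one quantity between ends that coincide by [bE], so both row inequalities
   are equalities. *)
have g1 : (a - alpha * t1) * (a - alpha * t2) * X <=
    (1 - alpha) * t1 * Y * (a - alpha * t2).
  by rewrite mulrAC ler_wpM2r // ltW.
have g2 : (1 - alpha) * t1 * Y * (a - alpha * t2) <=
    (1 - alpha) ^+ 2 * (t1 * t2) * X.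
  have -> : (1 - alpha) ^+ 2 * (t1 * t2) * X =
      ((1 - alpha) * t2 * X) * ((1 - alpha) * t1) by ring.
  have -> : (1 - alpha) * t1 * Y * (a - alpha * t2) =
      ((a - alpha * t2) * Y) * ((1 - alpha) * t1) by ring.
  by rewrite ler_wpM2r // mulr_ge0 // ltW.
have g3 : (1 - alpha) * t1 * Y * (a - alpha * t2) =
    (a - alpha * t1) * (a - alpha * t2) * X.
  by apply/eqP; rewrite eq_le g1 bE g2.
split=> //.
  by apply: (mulIf (lt0r_neq0 p2)); rewrite g3; ring.
apply: (mulIf (lt0r_neq0 (mulr_gt0 c0 t10))).
have -> : (1 - alpha) * t2 * X * ((1 - alpha) * t1) =
    (1 - alpha) ^+ 2 * (t1 * t2) * X by ring.
by rewrite -bE -g3; ring.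
Qed.

(** The discriminant equals [(alpha * (S1 - S2)) ^+ 2] plus a positive term, so its root exceeds
    [alpha * (S1 - S2)] in modulus. *)
Lemma quadratic_bound (alpha S1 S2 : R) :
  0 <= alpha < 1 -> 0 < S1 -> 0 < S2 ->
  let b := 1 / 2 * (alpha * (S1 + S2) +
    Num.sqrt (alpha ^+ 2 * (S1 + S2) ^+ 2 - 4 * (2 * alpha - 1) * S1 * S2)) in
  [/\ alpha * S1 < b, alpha * S2 < b &
      (b - alpha * S1) * (b - alpha * S2) = (1 - alpha) ^+ 2 * (S1 * S2)].
Proof.
move=> /andP[a0 a1] S10 S20; set D := (X in Num.sqrt X) => b.
have DE : D = (alpha * (S1 - S2)) ^+ 2 + 4 * (1 - alpha) ^+ 2 * (S1 * S2).
  by rewrite /D; ring.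
have pos : 0 < 4 * (1 - alpha) ^+ 2 * (S1 * S2).
  by rewrite !mulr_gt0 // ?exprn_gt0 //; lra.
have lt : `|alpha * (S1 - S2)| < Num.sqrt D.
  by rewrite -sqrtr_sqr ltr_sqrt DE ?ltrDl // ltr_pwDr // sqr_ge0.
have sq : Num.sqrt D ^+ 2 = D.
  by rewrite sqr_sqrtr // DE addr_ge0 ?sqr_ge0 // ltW.
move: lt; rewrite ltr_norml => /andP[lt1 lt2].
rewrite /b; split; [lra|lra|].
move: sq; rewrite DE; move: (Num.sqrt _) => s sq; lra.
Qed.

(** * Eigenvectors of the distance matrix as functions on vertices *)

Variables (V : finType) (e : rel V).
Hypotheses (eS : symmetric e) (eI : irreflexive e) (eC : connected_graph e).

Lemma eigenvalue_distance_alphaP (alpha a : R) :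
  reflect (exists x : V -> R, (exists w, x w != 0) /\ forall w,
     (a - alpha * (transmission e w)%:R) * x w =
     (1 - alpha) * \sum_u x u * (gdist e u w)%:R)
  (eigenvalue (distance_alpha_mx e alpha) a).
Proof.
have colE (v : 'rV[R]_#|V|) j : (v *m distance_alpha_mx e alpha) 0 j =
    alpha * (transmission e (enum_val j))%:R * v 0 j + (1 - alpha) *
    \sum_i v 0 i * (gdist e (enum_val i) (enum_val j))%:R.
  rewrite mulmxDr -!scalemxAr mxE; congr (_ + _).
    by rewrite mxE mul_mx_diag !mxE; ring.
  by rewrite !mxE; congr (_ * _); apply: eq_bigr => i _; rewrite !mxE.
apply: (iffP idP) => [/eigenvalueP[v vA v0]|[x [[w xw] xE]]].
  exists (fun w => v 0 (enum_rank w)); split.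
    have /existsP[j vj] : [exists j, v 0 j != 0].
      apply: contraNT v0 => /existsPn h; apply/eqP/rowP => j; rewrite mxE.
      by apply/eqP; have := h j; rewrite negbK.
    by exists (enum_val j); rewrite enum_valK.
  move=> w /=; have /rowP/(_ (enum_rank w)) := vA.
  rewrite colE enum_rankK mxE => vE; rewrite mulrBl -vE addrAC subrr add0r.
  congr (_ * _).
  rewrite [RHS](reindex_onto enum_val enum_rank) => [|u _]; last first.
    exact: enum_rankK.
  by apply: eq_big => [i|i _] /=; rewrite enum_valK ?eqxx.
apply/eigenvalueP; exists (\row_j x (enum_val j)); last first.
  apply: contra_neq xw => /rowP/(_ (enum_rank w)).
  by rewrite !mxE enum_rankK.
apply/rowP => j; rewrite colE !mxE.
have := xE (enum_val j); rewrite mulrBl => /eqP; rewrite subr_eq => /eqP ->.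
rewrite addrC; congr (_ * _ + _).
rewrite [RHS](reindex_onto enum_val enum_rank) /= => [|u _]; last first.
  exact: enum_rankK.
by apply: eq_big => [i|i _]; rewrite ?enum_valK ?eqxx // mxE.
Qed.

Lemma max_two_entries (y : V -> R) : (1 < #|V|)%N ->
  exists u v, [/\ u != v, forall w, y w <= y u &
    forall w, w != u -> y w <= y v].
Proof.
move=> V1; have /card_gt0P[w0 _] : (0 < #|V|)%N by lia.
have [u _ uP] := @arg_maxP _ R V w0 xpredT y isT.
have /card_gt0P[w1] : (0 < #|[set~ u]|)%N by rewrite cardsC1; lia.
rewrite !inE => w1u.
have [v vu vP] := @arg_maxP _ R V w1 (fun w => w != u) y w1u.
by exists u, v; split => // [|w]; [rewrite eq_sym|apply: uP].
Qed.

(** Take moduli in row [u]. Since [gdist e u u = 0], the entry at [u] is absent from the sum, so [m]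
    need only bound the others. Equality holds termwise, and the nonzero distances cancel. *)
Lemma eigen_entry_le (alpha a m : R) (x : V -> R) u :
  alpha < 1 ->
  (forall w, (a - alpha * (transmission e w)%:R) * x w =
     (1 - alpha) * \sum_u x u * (gdist e u w)%:R) ->
  (forall w, w != u -> `|x w| <= m) ->
  (a - alpha * (transmission e u)%:R) * `|x u| <=
    (1 - alpha) * (transmission e u)%:R * m /\
  ((a - alpha * (transmission e u)%:R) * `|x u| =
    (1 - alpha) * (transmission e u)%:R * m -> forall w, w != u -> `|x w| = m).
Proof.
move=> a1 xE xm; have c0 : 0 < 1 - alpha by lra.
have TE : (transmission e u)%:R * m = \sum_w m * (gdist e w u)%:R :> R.
  rewrite /transmission natr_sum mulr_suml; apply: eq_bigr => w _.
  by rewrite mulrC gdistC.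
have le1 : (a - alpha * (transmission e u)%:R) * `|x u| <=
    (1 - alpha) * \sum_w `|x w| * (gdist e w u)%:R.
  (* The coefficient may be negative; it is at most its absolute value. *)
  apply: le_trans (ler_wpM2r (normr_ge0 _) (ler_norm _)) _.
  rewrite -normrM xE normrM gtr0_norm // ler_wpM2l ?(ltW c0) //.
  apply: le_trans (ler_norm_sum _ _ _) _.
  by apply: ler_sum => w _; rewrite normrM normr_nat.
have termwise w : `|x w| * (gdist e w u)%:R <= m * (gdist e w u)%:R.
  have [->|wu] := eqVneq w u; first by rewrite gdistxx // !mulr0.
  by rewrite ler_wpM2r // xm.
have le2 : \sum_w `|x w| * (gdist e w u)%:R <= (transmission e u)%:R * m.
  by rewrite TE; apply: ler_sum => w _; exact: termwise.
split; first by rewrite -mulrA (le_trans le1) // ler_wpM2l // ltW.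
rewrite -mulrA => eq1 w wu.
have sumE : \sum_w `|x w| * (gdist e w u)%:R = \sum_w m * (gdist e w u)%:R.
  rewrite -TE; apply/eqP; rewrite eq_le le2 /=.
  by move: le1; rewrite eq1 ler_pM2l.
have [_] := leif_sum (P := xpredT)
  (fun (w : V) _ => leif_eq (termwise w)).
rewrite sumE eqxx => /esym/forallP/(_ w)/eqP.
by apply: mulIf; rewrite pnatr_eq0 gdist_eq0.
Qed.

Lemma eigenvalue_le_quadratic (alpha a S1 S2 : R) (x : V -> R) u v :
  0 <= alpha < 1 -> (1 < #|V|)%N ->
  (forall w, (a - alpha * (transmission e w)%:R) * x w =
     (1 - alpha) * \sum_u x u * (gdist e u w)%:R) ->
  u != v -> x u != 0 ->
  (forall w, `|x w| <= `|x u|) -> (forall w, w != u -> `|x w| <= `|x v|) ->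
  (transmission e u)%:R <= S1 -> (transmission e v)%:R <= S2 ->
  let b := 1 / 2 * (alpha * (S1 + S2) +
    Num.sqrt (alpha ^+ 2 * (S1 + S2) ^+ 2 - 4 * (2 * alpha - 1) * S1 * S2)) in
  a <= b /\
  (a = b -> (2 < #|V|)%N -> S1 = S2 /\ forall w, S1 <= (transmission e w)%:R).
Proof.
move=> a01 V1 xE uv xu xmax xmax2 T1 T2 b.
have /andP[_ a1] := a01.
have T0 w : 0 < (transmission e w)%:R :> R by rewrite ltr0n transmission_gt0.
have S10 := lt_le_trans (T0 u) T1; have S20 := lt_le_trans (T0 v) T2.
have [b1 b2 bE] := quadratic_bound a01 S10 S20.
have [h1 eq1] := eigen_entry_le a1 xE xmax2.
have [h2 eq2] := eigen_entry_le (u := v) a1 xE (fun w _ => xmax w).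
have X0 : 0 < `|x u| by rewrite normr_gt0.
have [ab abE] := two_entry_bound a01 (introT andP (conj (T0 u) T1))
  (introT andP (conj (T0 v) T2)) b1 b2 bE X0 h1 h2.
split=> // /abE [t1 t2 e1 e2] V2.
(* Equality in row [u] gives [w0] the modulus of [v], and equality in row [v] gives it that of [u];
   hence all moduli agree. *)
have [w0] : exists w, w \notin [set u; v].
  apply/existsP; rewrite -negb_forall; apply: contraL V2 => /forallP h.
  have -> : #|V| = #|[set u; v]|.
    by rewrite -cardsT; apply: eq_card => w; rewrite h inE.
  by rewrite cards2 uv.
rewrite !inE negb_or => /andP[w0u w0v].
have yE w : `|x w| = `|x u|.
  have [->|wv] := eqVneq w v; last exact: eq2.
  by rewrite -(eq1 e1 _ w0u) (eq2 e2).
(* With all moduli equal, the inequality for row [w] reduces to this. *)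
have aE w : a <= (transmission e w)%:R.
  have [+ _] := eigen_entry_le (u := w) a1 xE (fun w _ => xmax w).
  by rewrite yE ler_pM2r //; lra.
have a1E : a = S1.
  apply: (mulIf (lt0r_neq0 X0)); move: e1; rewrite yE t1; lra.
have a2E : a = S2.
  apply: (mulIf (lt0r_neq0 X0)); move: e2; rewrite yE t2; lra.
by rewrite -a1E -a2E.
Qed.

Lemma transmission_const_eigenvalue (alpha t : R) : (0 < #|V|)%N ->
  (forall w, (transmission e w)%:R = t) ->
  eigenvalue (distance_alpha_mx e alpha) t.
Proof.
move=> /card_gt0P[w0 _] tE; apply/eigenvalue_distance_alphaP.
exists (fun=> 1); split; first by exists w0; rewrite oner_eq0.
move=> w; rewrite tE; have -> : \sum_u 1 * (gdist e u w)%:R = t.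
  rewrite -(tE w) /transmission natr_sum; apply: eq_bigr => u _.
  by rewrite mul1r gdistC.
by ring.
Qed.

(** At the minimum degree this is [S], at the second minimum degree [S']. For positive diameter it
    is nonincreasing in [k]. *)
Definition transmission_bound (k : R) : R :=
  (diameter e)%:R * #|V|%:R - (diameter e)%:R * ((diameter e)%:R - 1) / 2 - 1
  - k * ((diameter e)%:R - 1).

Lemma transmission_boundB u : (0 < diameter e)%N ->
  2 * (transmission_bound (degree e u)%:R - (transmission e u)%:R) =
  (2 * (diameter e * #|V|))%N%:R - (2 * transmission e u +
    (2 + 2 * degree e u * (diameter e).-1 + (diameter e).-1 * diameter e))%N%:R.
Proof.
move=> d0; rewrite /transmission_bound -subn1 !(natrD, natrM) natrB //.
by field.
Qed.

Lemma transmission_le_bound u : (0 < diameter e)%N ->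
  (transmission e u)%:R <= transmission_bound (degree e u)%:R.
Proof.
move=> d0; rewrite -subr_ge0 -(pmulr_rge0 _ (ltr0Sn R 1)).
rewrite transmission_boundB //.
by rewrite subr_ge0 ler_nat transmission_le.
Qed.

Lemma transmission_eq_boundP u : (0 < diameter e)%N ->
  (transmission e u)%:R = transmission_bound (degree e u)%:R <->
  (2 * transmission e u + (2 + 2 * degree e u * (diameter e).-1 +
   (diameter e).-1 * diameter e) = 2 * (diameter e * #|V|))%N.
Proof.
move=> d0; have h := transmission_boundB u d0; split=> [tE|nE].
  by apply/eqP; rewrite -(eqr_nat R); apply/eqP; move: h; rewrite tE; lra.
by move: h; rewrite nE; lra.
Qed.

End Analysis.

Theorem theorem3p3 (R : realType) (alpha : R) (V : finType) (e : rel V) :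
  0 <= alpha < 1 ->
  simple_graph e -> connected_graph e -> (2 <= #|V|)%N ->
  let n : R := #|V|%:R in
  let delta : R := (min_degree e)%:R in
  let delta' : R := (second_min_degree e)%:R in
  let d : R := (diameter e)%:R in
  let S := d * n - d * (d - 1) / 2 - 1 - delta * (d - 1) in
  let S' := d * n - d * (d - 1) / 2 - 1 - delta' * (d - 1) in
  let B := 2 * d * n - 2 - (d - 1) * (d + delta + delta') in
  let mu := distance_alpha_spectral_radius e alpha in
  let bound := 1 / 2 * (alpha * B +
    Num.sqrt (alpha ^+ 2 * B ^+ 2 - 4 * (2 * alpha - 1) * S * S')) in
  mu <= bound /\ (mu = bound <-> regular e /\ (diameter e <= 2)%N).
Proof.
move=> a01 [eS eI] eC V1 n delta delta' d S S' B mu bound.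
have V0 : (0 < #|V|)%N by exact: ltnW.
have d0 := diameter_gt0 eC V1.
have d1 : 0 <= d - 1 by rewrite subr_ge0 ler1n.
pose Sg (w : V) : R := transmission_bound e (degree e w)%:R.
have TS w : (transmission e w)%:R <= Sg w by exact: transmission_le_bound.
have SgS w : Sg w <= S.
  by rewrite lerD2l lerN2 ler_wpM2r // ler_nat min_degree_le.
have BE : B = S + S' by rewrite /B /S /S'; field.
have [muE mu_max] := distance_alpha_spectral_radiusP alpha V0 eS.
have [x [[w0 xw0] xE]] := eigenvalue_distance_alphaP _ _ _ muE.
have [u [v [uv xmax xmax2]]] := max_two_entries (fun w => `|x w|) V1.
have xu : x u != 0.
  by rewrite -normr_gt0 (lt_le_trans _ (xmax w0)) // normr_gt0.
have SgS' w : (second_min_degree e <= degree e w)%N -> Sg w <= S'.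
  by move=> h; rewrite lerD2l lerN2 ler_wpM2r // ler_nat.
have [le_bound eq_bound] : mu <= bound /\
    (mu = bound -> (2 < #|V|)%N ->
      S = S' /\ forall w, S <= (transmission e w)%:R).
  (* One of [u], [v] has degree at least the second minimum, so its transmission is at most [S'] and
     the other's at most [S]. The bound is symmetric in [S] and [S']. *)
  have [hu|hv] := orP (second_min_degree_le e uv).
    have [] := @eigenvalue_le_quadratic R V e eS eC alpha mu S' S x u v a01 V1
      xE uv xu xmax xmax2 (le_trans (TS u) (SgS' u hu))
      (le_trans (TS v) (SgS v)).
    rewrite (addrC S') -BE (mulrAC _ S' S) => h1 h2; split=> //.
    by move=> /h2{}h2 /h2[<- h].
  have [] := @eigenvalue_le_quadratic R V e eS eC alpha mu S S' x u v a01 V1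
      xE uv xu xmax xmax2 (le_trans (TS u) (SgS u))
      (le_trans (TS v) (SgS' v hv)).
  by rewrite -BE.
split=> //; split=> [mub|[[r rP] d2]].
  have [d2|d2] := leqP (diameter e) 1.
    by split; [exact: (regular_of_diameter1 eI eC) | exact: leqW].
  have [_ ST] := eq_bound mub (card_gt2_of_diameter eI eC d2).
  have dn1 : d - 1 != 0 by rewrite subr_eq0 pnatr_eq1; lia.
  (* [S <= T(w) <= Sg w <= S] gives [Sg w = S], and the two sides differ by [(d - 1)] times the
     excess of the degree of [w] over [delta]. *)
  have reg : regular e.
    exists (min_degree e) => w; apply/eqP; rewrite -(eqr_nat R); apply/eqP.
    apply: (mulIf dn1); have := le_trans (ST w) (TS w); have := SgS w.
    by rewrite /Sg /transmission_bound /S -/n -/d -/delta; lra.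
  split=> //; apply: (regular_card_ball2_diameter eS eI eC reg) => d3 w.
  apply: (transmission_eq_card_ball2 eS eI eC d3).
  apply/(transmission_eq_boundP R w d0)/le_anti; rewrite TS /=.
  exact: le_trans (SgS w) (ST w).
have deltaE : delta = r%:R.
  have [w wE] := @degree_sequence_nth_mem V e (#|V| - 1) ltac:(lia).
  by rewrite /delta /min_degree wE rP.
have delta'E : delta' = r%:R.
  have [w wE] := @degree_sequence_nth_mem V e (#|V| - 2) ltac:(lia).
  by rewrite /delta' /second_min_degree wE rP.
have TE w : (transmission e w)%:R = S.
  have -> : S = Sg w by rewrite /S /Sg rP deltaE.
  apply/(transmission_eq_boundP R w d0).
  by apply: (transmission_eq_of_diameter_le2 eI eC); rewrite d0.
(* The constant transmission [S] is an eigenvalue, so [S <= mu]; it remains to see that the bound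
   itself equals [S]. *)
apply/le_anti; rewrite le_bound /=.
apply: le_trans (mu_max _ (transmission_const_eigenvalue eS eC alpha V0 TE)).
have S0 : 0 <= S by rewrite -(TE w0) ler0n.
have S'E : S' = S by rewrite /S' /S delta'E deltaE.
have /andP[_ a1] := a01.
rewrite /bound BE S'E.
have -> : alpha ^+ 2 * (S + S) ^+ 2 - 4 * (2 * alpha - 1) * S * S =
    (2 * (1 - alpha) * S) ^+ 2 by ring.
rewrite sqrtr_sqr ger0_norm; last by rewrite !mulr_ge0 //; lra.
by lra.
Qed.
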